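(* Let $\hat{\boldsymbol\beta}(z)$, $\boldsymbol s(z)$, $\mathcal A_z$, $\mathcal A_z^c$, $\boldsymbol\psi_{\mathcal A_z}(z)$, $\boldsymbol\gamma_{\mathcal A_z^c}(z)$ be defined as in the context for the Lasso with parametrized response $\boldsymbol y(z)=\boldsymbol a+\boldsymbol bz$, $z\in\mathbb R$, and regularization parameter $\lambda\ge0$. Let $z$ be a real value such that $\max_{j\in\mathcal A_z^c}|s_j(z)|<1$. Then $\mathcal A_{z'}=\mathcal A_z$, $\max_{j\in\mathcal A_{z'}^c}|s_j(z')|<1$, and $\boldsymbol s(z)=\boldsymbol s(z')$ for any real value $z'$ in the interval $[z,z+t_z)$, where $z+t_z$ is the value of the transition point and $$t_z=\min\{t_z^1,t_z^2\},\qquad t_z^1=\min_{j\in\mathcal A_z}\left(-\frac{\hat\beta_j(z)}{\psi_j(z)}\right)_{++},\qquad t_z^2=\min_{j\in\mathcal A_z^c}\left(\lambda\,\frac{\operatorname{sign}(\gamma_j(z))-s_j(z)}{\gamma_j(z)}\right)_{++}.$$ Here, for any $m\in\mathbb R$, $(m)_{++}=m$ if $m>0$, and $(m)_{++}=\infty$ otherwise.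
   Context: Data: $X\in\mathbb R^{n\times p}$ is a feature matrix, $\boldsymbol y^{\rm obs}\in\mathbb R^n$ an observed response, $\Sigma\in\mathbb R^{n\times n}$ a covariance matrix, $\lambda\ge0$ a regularization parameter. For an index set $S\subseteq\{1,\dots,p\}$, $X_S$ is the submatrix of $X$ with columns indexed by $S$, and $\boldsymbol v_S$ is the subvector of $\boldsymbol v$ with entries indexed by $S$. Line in data space: let $\mathcal A_{\rm obs}$ be the set of indices of nonzero entries of the Lasso solution $\arg\min_{\boldsymbol\beta\in\mathbb R^p}\frac12\|\boldsymbol y^{\rm obs}-X\boldsymbol\beta\|_2^2+\lambda\|\boldsymbol\beta\|_1$. Fix one selected feature and let $\boldsymbol e\in\mathbb R^{|\mathcal A_{\rm obs}|}$ be the standard basis vector with a 1 in the position of that feature. Put $\boldsymbol\eta=X_{\mathcal A_{\rm obs}}(X_{\mathcal A_{\rm obs}}^\top X_{\mathcal A_{\rm obs}})^{-1}\boldsymbol e$, $\boldsymbol b=\Sigma\boldsymbol\eta(\boldsymbol\eta^\top\Sigma\boldsymbol\eta)^{-1}\in\mathbb R^n$, $\boldsymbol a=(I_n-\boldsymbol b\boldsymbol\eta^\top)\boldsymbol y^{\rm obs}\in\mathbb R^n$ (the inverses being assumed to exist), and $\boldsymbol y(z)=\boldsymbol a+\boldsymbol b z$ for $z\in\mathbb R$. Parametrized Lasso: for each $z\in\mathbb R$, $$\hat{\boldsymbol\beta}(z)=\arg\min_{\boldsymbol\beta\in\mathbb R^p}\tfrac12\|\boldsymbol y(z)-X\boldsymbol\beta\|_2^2+\lambda\|\boldsymbol\beta\|_1.$$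 The vector $\boldsymbol s(z)\in\partial\|\hat{\boldsymbol\beta}(z)\|_1$ is a subgradient of the $\ell_1$-norm at $\hat{\boldsymbol\beta}(z)$, i.e. $s_j(z)=\operatorname{sign}(\hat\beta_j(z))$ if $\hat\beta_j(z)\ne0$ and $s_j(z)\in[-1,1]$ if $\hat\beta_j(z)=0$, satisfying the optimality condition $X^\top(X\hat{\boldsymbol\beta}(z)-\boldsymbol y(z))+\lambda\boldsymbol s(z)=0$; the source also denotes this by $\boldsymbol s(z)=\operatorname{sign}(\hat{\boldsymbol\beta}(z))$, and it describes the equality $\boldsymbol s(z)=\boldsymbol s(z')$ as the signs of the Lasso solution remaining the same. The active set is $\mathcal A_z=\{j:\hat\beta_j(z)\neq0\}$ and the inactive set is $\mathcal A_z^c=\{1,\dots,p\}\setminus\mathcal A_z$. Transition point: as $z$ increases, the solution $\hat{\boldsymbol\beta}(z)$ is a linear function of $z$ until $z$ reaches a transition point, at which either an (active) element of $\hat{\boldsymbol\beta}(z)$ becomes zero or an (inactive) component of $\boldsymbol s(z)$ becomes one in absolute value. Standing assumptions: for every $z\in\mathbb R$ the Lasso solution $\hat{\boldsymbol\beta}(z)$ is unique and $X_{\mathcal A_z}^\top X_{\mathcal A_z}$ is invertible (justified when the columns of $X$ are in general position). Notation: $\boldsymbol\psi_{\mathcal A_z}(z)=(X_{\mathcal A_z}^\top X_{\mathcal A_z})^{-1}X_{\mathcal A_z}^\top\boldsymbol b$, with entries $\psi_j(z)$, $j\in\mathcal A_z$; $\boldsymbol\gamma_{\mathcal A_z^c}(z)=X_{\mathcal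 A_z^c}^\top\boldsymbol b-X_{\mathcal A_z^c}^\top X_{\mathcal A_z}\boldsymbol\psi_{\mathcal A_z}(z)$, with entries $\gamma_j(z)$, $j\in\mathcal A_z^c$.
   Formalization: The bound max|s_j(z)|<1 is assumed for every admissible subgradient at z (same if λ>0; for λ=0 one arbitrary choice makes the claim false), and s(z)=s(z') is read as sign β̂(z)=sign β̂(z'), as inactive subgradient entries move with z. *)

(* Defs.v *)
From HB Require Import structures.
From mathcomp Require Import all_boot all_order all_algebra.
From mathcomp Require Import reals constructive_ereal.

(* MathComp world; [R : realType] stands for the real numbers. *)

Set Implicit Arguments.
Unset Strict Implicit.
Unset Printing Implicit Defensive.
Import Order.TTheory GRing.Theory Num.Theory.
Local Open Scope ring_scope.

Definition colsel (R : realType) (n p : nat) (X : 'M[R]_(n, p))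
  (S : {set 'I_p}) : 'M[R]_(n, #|S|) := colsub (@enum_val _ S) X.

Definition gram (R : realType) (n p : nat) (X : 'M[R]_(n, p))
  (S : {set 'I_p}) : 'M[R]_#|S| := (colsel X S)^T *m colsel X S.

Definition covariance_mx (R : realType) (n : nat) (Sigma : 'M[R]_n) : Prop :=
  Sigma^T = Sigma /\ forall v : 'cV[R]_n, 0 <= (v^T *m Sigma *m v) 0 0.

Definition l1norm (R : realType) (p : nat) (v : 'cV[R]_p) : R :=
  \sum_j `|v j 0|.

Definition l2norm (R : realType) (n : nat) (v : 'cV[R]_n) : R :=
  Num.sqrt (\sum_i v i 0 ^+ 2).

Definition lasso_obj (R : realType) (n p : nat) (X : 'M[R]_(n, p))
  (y : 'cV[R]_n) (lam : R) (beta : 'cV[R]_p) : R :=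
  2^-1 * l2norm (y - X *m beta) ^+ 2 + lam * l1norm beta.

Definition lasso_argmin (R : realType) (n p : nat) (X : 'M[R]_(n, p))
  (y : 'cV[R]_n) (lam : R) (beta : 'cV[R]_p) : Prop :=
  forall beta' : 'cV[R]_p, lasso_obj X y lam beta <= lasso_obj X y lam beta'.

Definition lasso_unique_argmin (R : realType) (n p : nat) (X : 'M[R]_(n, p))
  (y : 'cV[R]_n) (lam : R) (beta : 'cV[R]_p) : Prop :=
  lasso_argmin X y lam beta /\
  forall beta' : 'cV[R]_p, lasso_argmin X y lam beta' -> beta' = beta.

Definition active (R : realType) (p : nat) (beta : 'cV[R]_p) : {set 'I_p} :=
  [set j | beta j 0 != 0].

Definition sgv (R : realType) (p : nat) (beta : 'cV[R]_p) : 'cV[R]_p :=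
  map_mx Num.sg beta.

Definition l1_subgrad (R : realType) (p : nat) (beta s : 'cV[R]_p) : Prop :=
  forall j, (beta j 0 != 0 -> s j 0 = Num.sg (beta j 0)) /\
            (beta j 0 = 0 -> -1 <= s j 0 <= 1).

Definition lasso_subgrad (R : realType) (n p : nat) (X : 'M[R]_(n, p))
  (y : 'cV[R]_n) (lam : R) (beta s : 'cV[R]_p) : Prop :=
  l1_subgrad beta s /\ X^T *m (X *m beta - y) + lam *: s = 0.

(* For [lam = 0] the optimality condition does not determine [s] on the inactive
   set; a strict bound on the inactive subgradient components at z is then only
   meaningful when required of every admissible [s]. For [lam > 0] there is
   only one. *)
Lemma lasso_subgrad_uniq (R : realType) (n p : nat) (X : 'M[R]_(n, p))
  (y : 'cV[R]_n) (lam : R) (beta s s' : 'cV[R]_p) : 0 < lam ->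
  lasso_subgrad X y lam beta s -> lasso_subgrad X y lam beta s' -> s = s'.
Proof.
move=> lam_gt0 [_ es] [_ es']; apply: (scalerI (lt0r_neq0 lam_gt0)).
by apply: (addrI (X^T *m (X *m beta - y))); rewrite es es'.
Qed.

(* All terms are nonnegative, so the default value 0 only matters for an empty
   inactive set, over which a bound [max < 1] holds vacuously. *)
Definition inactive_max (R : realType) (p : nat) (beta s : 'cV[R]_p) : R :=
  \big[Order.max/0]_(j in ~: active beta) `|s j 0|.

(* The entry at [k : 'I_#|S|] belongs to the feature [enum_val k]; the same
   holds for [gamma] below. *)
Definition psi (R : realType) (n p : nat) (X : 'M[R]_(n, p)) (b : 'cV[R]_n)
  (S : {set 'I_p}) : 'cV[R]_#|S| :=
  invmx (gram X S) *m (colsel X S)^T *m b.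

Definition gamma (R : realType) (n p : nat) (X : 'M[R]_(n, p)) (b : 'cV[R]_n)
  (S : {set 'I_p}) : 'cV[R]_#|~: S| :=
  (colsel X (~: S))^T *m b - (colsel X (~: S))^T *m colsel X S *m psi X b S.

Definition ppart (R : realType) (m : R) : \bar R :=
  if 0 < m then m%:E else +oo%E.

(* In [step1] and [step2] a zero denominator makes the quotient 0 and hence the
   term +oo: the corresponding coordinate does not move with z. *)
Definition step1 (R : realType) (n p : nat) (X : 'M[R]_(n, p)) (b : 'cV[R]_n)
  (beta : 'cV[R]_p) : \bar R :=
  \big[Order.min/+oo%E]_(k < #|active beta|)
    ppart (- (beta (enum_val k) 0 / psi X b (active beta) k 0)).

Definition step2 (R : realType) (n p : nat) (X : 'M[R]_(n, p)) (b : 'cV[R]_n)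
  (lam : R) (beta s : 'cV[R]_p) : \bar R :=
  \big[Order.min/+oo%E]_(k < #|~: active beta|)
    let g := gamma X b (active beta) k 0 in
    ppart (lam * ((Num.sg g - s (enum_val k) 0) / g)).

Definition step (R : realType) (n p : nat) (X : 'M[R]_(n, p)) (b : 'cV[R]_n)
  (lam : R) (beta s : 'cV[R]_p) : \bar R :=
  Order.min (step1 X b beta) (step2 X b lam beta s).

(* At r, an element active at z has become zero, or the subgradient component
   of an element inactive at z has become one in absolute value. *)
Definition transition_event (R : realType) (p : nat)
  (beta s : R -> 'cV[R]_p) (z r : R) : Prop :=
  (exists2 j, j \in active (beta z) & beta r j 0 = 0) \/
  (exists2 j, j \in ~: active (beta z) & `|s r j 0| = 1).

(* [tau] is the first transition point after z; [tau = +oo] means that no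
   transition occurs to the right of z. *)
Definition transition_point (R : realType) (p : nat)
  (beta s : R -> 'cV[R]_p) (z : R) (tau : \bar R) : Prop :=
  [/\ (z%:E < tau)%E,
      exists v : 'cV[R]_p, forall r : R, z <= r -> (r%:E < tau)%E ->
        beta r = beta z + (r - z) *: v,
      forall r : R, z <= r -> (r%:E < tau)%E -> ~ transition_event beta s z r
    & forall r : R, tau = r%:E -> transition_event beta s z r].

(* Main.v *)
(** The optimality conditions are sufficient for a Lasso minimum, so by uniqueness
    it is enough to exhibit a solution of them. With [A] the active set at [z],
    move [beta z] along the vector [v] equal to [psi] on [A] and 0 elsewhere, and
    [s z] along [lam^-1 *: w] with [w = X^T (b - X v)], which vanishes on [A] and
    equals [gamma] off [A]; the stationarity equation is preserved. The time
    [step] is exactly the first one at which an active coefficient reaches 0 or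
    an inactive subgradient component reaches absolute value 1; by continuity
    the conditions still hold at that time, which makes it a transition. If
    [lam = 0] the hypothesis at [z] leaves no inactive feature. *)

Require Import Defs.
From HB Require Import structures.
From mathcomp Require Import all_boot all_order all_algebra.
From mathcomp Require Import reals constructive_ereal.
From mathcomp Require Import boolp ring lra.

Set Implicit Arguments.
Unset Strict Implicit.
Unset Printing Implicit Defensive.
Import Order.TTheory GRing.Theory Num.Theory.
Local Open Scope ring_scope.

(** * Sufficiency of the optimality conditions *)

Lemma l2norm_sqr (R : realType) (n : nat) (v : 'cV[R]_n) :
  l2norm v ^+ 2 = (v^T *m v) 0 0.
Proof.
rewrite /l2norm sqr_sqrtr; last by apply: sumr_ge0 => i _; exact: sqr_ge0.
by rewrite mxE; apply: eq_bigr => i _; rewrite mxE expr2.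
Qed.

(** Coordinatewise: where [beta j 0] is zero, [|s j 0| <= 1] suffices; elsewhere [s j 0 * beta j 0]
    is the absolute value of [beta j 0], and a number times a sign never exceeds its absolute
    value. *)
Lemma l1_subgrad_le (R : realType) (p : nat) (beta s beta' : 'cV[R]_p) :
  l1_subgrad beta s ->
  l1norm beta + (s^T *m (beta' - beta)) 0 0 <= l1norm beta'.
Proof.
move=> hs; rewrite mxE /l1norm -big_split /=; apply: ler_sum => j _.
rewrite !mxE; have [h1 h0] := hs j.
have [b0|bn0] := eqVneq (beta j 0) 0.
  rewrite b0 normr0 add0r subr0; have := h0 b0.
  rewrite -ler_norml => sj; apply: le_trans (ler_norm _) _.
  by rewrite normrM ler_piMl.
rewrite (h1 bn0) mulrBr -normrEsg addrC subrK; apply: le_trans (ler_norm _) _.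
by rewrite normrM normr_sg bn0 mul1r.
Qed.

(** With [d = beta' - beta], stationarity makes the linear term of the expanded square a multiple of
    [s^T *m d], which the subgradient inequality absorbs; half the squared norm of [X *m d] is left
    over, and it is nonnegative. *)
Lemma lasso_subgrad_argmin (R : realType) (n p : nat) (X : 'M[R]_(n, p))
  (y : 'cV[R]_n) (lam : R) (beta s : 'cV[R]_p) : 0 <= lam ->
  lasso_subgrad X y lam beta s -> lasso_argmin X y lam beta.
Proof.
move=> lam0 [hs hopt] beta'; rewrite /lasso_obj !l2norm_sqr.
have := ler_wpM2l lam0 (l1_subgrad_le beta' hs).
set d := beta' - beta; set r := y - X *m beta.
have rE : X^T *m r = lam *: s.
  by rewrite /r -opprB mulmxN; apply/eqP; rewrite eqr_oppLR -addr_eq0 hopt.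
have -> : y - X *m beta' = r - X *m d by rewrite /r /d mulmxBr opprB addrA subrK.
clearbody d r.
have cross : (r^T *m (X *m d)) 0 0 = lam * (s^T *m d) 0 0.
  have -> : r^T *m (X *m d) = lam *: (s^T *m d).
    by rewrite mulmxA -[r^T *m X]trmxK trmx_mul trmxK rE linearZ /= -scalemxAl.
  by rewrite mxE.
have crossT : ((X *m d)^T *m r) 0 0 = lam * (s^T *m d) 0 0.
  rewrite -cross; move: (X *m d) => e.
  by rewrite -[RHS]trace_mx11 -mxtrace_tr trmx_mul trmxK trace_mx11.
have sq0 : 0 <= ((X *m d)^T *m (X *m d)) 0 0 by rewrite -l2norm_sqr sqr_ge0.
have -> : ((r - X *m d)^T *m (r - X *m d)) 0 0 = (r^T *m r) 0 0
    - lam * (s^T *m d) 0 0 *+ 2 + ((X *m d)^T *m (X *m d)) 0 0.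
  rewrite [(r - _)^T]linearB /= mulmxBl !mulmxBr.
  have entryB (A B C D : 'M[R]_1) :
      (A - B - (C - D)) 0 0 = A 0 0 - B 0 0 - C 0 0 + D 0 0.
    by rewrite !mxE; ring.
  by rewrite entryB cross crossT; ring.
by move=> h; lra.
Qed.

(** * Hitting times of a single coordinate *)

(** For nonzero [d], [- (x / d)] is the only root of [x + t * d] in [t], so an affine function
    starting at [x != 0] keeps its sign before that time, or forever if the root is not positive. *)
Lemma ppart_sg_stable (R : realType) (x d t : R) : x != 0 -> 0 <= t ->
  (t%:E < ppart (- (x / d)))%E -> Num.sg (x + t * d) = Num.sg x.
Proof.
(* Negating both [x] and [d] leaves the quotient unchanged and flips both signs. *)
move=> x0 t0; wlog xp : x d x0 / 0 < x.
  move=> W; have [|xn] := ltP 0 x; first exact: W.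
  have xn' : 0 < - x by rewrite oppr_gt0 lt_neqAle x0.
  have := W (- x) (- d); rewrite oppr_eq0 invrN mulrNN mulrN -opprD !sgrN.
  by move=> W' h; apply: oppr_inj; exact: W'.
move=> h; rewrite (gtr0_sg xp) gtr0_sg //.
have [d0|dn] := leP 0 d; first by rewrite ltr_wpDr// mulr_ge0.
have q0 : 0 < - (x / d) by rewrite -mulrN -invrN divr_gt0 ?oppr_gt0.
move: h; rewrite /ppart q0 lte_fin -mulrN -invrN ltr_pdivlMr ?oppr_gt0//; lra.
Qed.

(** A finite value of [ppart] is a positive quotient, which excludes [d = 0]. *)
Lemma ppart_root (R : realType) (x d t : R) :
  t%:E = ppart (- (x / d)) -> x + t * d = 0.
Proof.
rewrite /ppart; case: ifP => // q0 [->]; have [d0|dn] := eqVneq d 0.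
  by move: q0; rewrite d0 invr0 mulr0 oppr0 ltxx.
by rewrite mulNr divfK ?subrr.
Qed.

Lemma ppart_sg_le (R : realType) (x d t : R) : x != 0 -> 0 <= t ->
  (t%:E <= ppart (- (x / d)))%E -> x + t * d != 0 ->
  Num.sg (x + t * d) = Num.sg x.
Proof.
move=> x0 t0; rewrite le_eqVlt => /orP[/eqP/ppart_root ->|h _].
  by rewrite eqxx.
exact: ppart_sg_stable.
Qed.

(** For nonzero [g], [s + u * g] with [u = t / lam] moves towards the bound [Num.sg g] and away from
    the opposite one; it arrives at [u = (Num.sg g - s) / g], which is positive because
    [|s| < 1]. *)
Lemma ppart_norm_lt1 (R : realType) (lam s g t : R) : 0 < lam -> `|s| < 1 ->
  0 <= t -> (t%:E < ppart (lam * ((Num.sg g - s) / g)))%E ->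
  `|s + t / lam * g| < 1.
Proof.
move=> lam0; rewrite ltr_norml => /andP[s1 s2] t0 h; rewrite ltr_norml.
have u0 : 0 <= t / lam by rewrite divr_ge0// ltW.
have [->|g0] := eqVneq g 0; first by rewrite mulr0 addr0 s1.
have q0 : 0 < lam * ((Num.sg g - s) / g).
  rewrite mulr_gt0//; have [gp|gn] := ltP 0 g.
    by rewrite gtr0_sg// divr_gt0// subr_gt0.
  have gn' : g < 0 by rewrite lt_neqAle g0.
  by rewrite ltr0_sg// -mulrNN -invrN divr_gt0 ?oppr_gt0// subr_lt0.
move: h; rewrite /ppart q0 lte_fin mulrC -ltr_pdivrMr//.
move: u0; set u := t / lam => u0.
have [gp|gn] := ltP 0 g.
  have ug : 0 <= u * g by rewrite mulr_ge0// ltW.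
  by rewrite gtr0_sg// ltr_pdivlMr// => h; apply/andP; split; lra.
have ug : u * g <= 0 by rewrite mulr_ge0_le0.
have gn' : g < 0 by rewrite lt_neqAle g0.
rewrite ltr0_sg// ltr_ndivlMr// => h.
by apply/andP; split; lra.
Qed.

(** Finiteness excludes [lam = 0] and [g = 0]; the coordinate then equals [Num.sg g]. *)
Lemma ppart_norm_eq1 (R : realType) (lam s g t : R) :
  t%:E = ppart (lam * ((Num.sg g - s) / g)) -> `|s + t / lam * g| = 1.
Proof.
rewrite /ppart; case: ifP => // q0 [->].
have [l0|ln] := eqVneq lam 0; first by move: q0; rewrite l0 mul0r ltxx.
have [d0|gn] := eqVneq g 0; first by move: q0; rewrite d0 invr0 !mulr0 ltxx.
by rewrite [lam * _]mulrC mulfK// divfK// addrC subrK normr_sg gn.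
Qed.

Lemma ppart_norm_le1 (R : realType) (lam s g t : R) : 0 < lam -> `|s| < 1 ->
  0 <= t -> (t%:E <= ppart (lam * ((Num.sg g - s) / g)))%E ->
  `|s + t / lam * g| <= 1.
Proof.
move=> lam0 s1 t0; rewrite le_eqVlt => /orP[/eqP/ppart_norm_eq1 ->//|h].
exact/ltW/ppart_norm_lt1.
Qed.

(** * Directions of the coefficient and subgradient paths *)

Lemma entry_addZ (R : realType) (p : nat) (u v : 'cV[R]_p) (t : R) (j : 'I_p) :
  (u + t *: v) j 0 = u j 0 + t * v j 0.
Proof. by rewrite !mxE. Qed.

(** The selected columns of the identity embed the coordinates in [S] into all features, so this is
    [psi] extended by zero. *)
Definition path_dir (R : realType) (n p : nat) (X : 'M[R]_(n, p))
  (b : 'cV[R]_n) (S : {set 'I_p}) : 'cV[R]_p := colsel 1%:M S *m psi X b S.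

(* The subgradient moves along [lam^-1 *: dual_dir]. *)
Definition dual_dir (R : realType) (n p : nat) (X : 'M[R]_(n, p))
  (b : 'cV[R]_n) (S : {set 'I_p}) : 'cV[R]_p :=
  X^T *m (b - X *m path_dir X b S).

Lemma colsel_trmulmx (R : realType) (n p : nat) (X : 'M[R]_(n, p))
  (S : {set 'I_p}) (u : 'cV[R]_n) (k : 'I_#|S|) :
  ((colsel X S)^T *m u) k 0 = (X^T *m u) (enum_val k) 0.
Proof. by rewrite !mxE; apply: eq_bigr => i _; rewrite !mxE. Qed.

Lemma mulmx_path_dir (R : realType) (n p : nat) (X : 'M[R]_(n, p))
  (b : 'cV[R]_n) (S : {set 'I_p}) :
  X *m path_dir X b S = colsel X S *m psi X b S.
Proof. by rewrite mulmxA /colsel mulmx_colsub mulmx1. Qed.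

Lemma path_dir_enum_val (R : realType) (n p : nat) (X : 'M[R]_(n, p))
  (b : 'cV[R]_n) (S : {set 'I_p}) (k : 'I_#|S|) :
  path_dir X b S (enum_val k) 0 = psi X b S k 0.
Proof.
rewrite /path_dir; move: (psi X b S) => v.
rewrite mxE (bigD1 k)//= !mxE eqxx mul1r big1 ?addr0// => i ik.
by rewrite !mxE (inj_eq enum_val_inj) eq_sym (negbTE ik) mul0r.
Qed.

Lemma path_dir_notin (R : realType) (n p : nat) (X : 'M[R]_(n, p))
  (b : 'cV[R]_n) (S : {set 'I_p}) (j : 'I_p) :
  j \notin S -> path_dir X b S j 0 = 0.
Proof.
move=> jS; rewrite mxE big1// => i _; rewrite !mxE.
case: eqP => [ji|]; last by rewrite mul0r.
by move: jS; rewrite ji enum_valP.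
Qed.

(** These are the normal equations for the least squares regression of [b] on the columns in [S]. *)
Lemma dual_dir_in (R : realType) (n p : nat) (X : 'M[R]_(n, p))
  (b : 'cV[R]_n) (S : {set 'I_p}) (j : 'I_p) :
  gram X S \in unitmx -> j \in S -> dual_dir X b S j 0 = 0.
Proof.
move=> gu jS; rewrite -(enum_rankK_in jS jS) -colsel_trmulmx mulmx_path_dir.
by rewrite mulmxBr !mulmxA mulmxV// mul1mx subrr mxE.
Qed.

Lemma dual_dir_enum_val (R : realType) (n p : nat) (X : 'M[R]_(n, p))
  (b : 'cV[R]_n) (S : {set 'I_p}) (k : 'I_#|~: S|) :
  dual_dir X b S (enum_val k) 0 = gamma X b S k 0.
Proof. by rewrite -colsel_trmulmx mulmx_path_dir mulmxBr mulmxA. Qed.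

(** * Consequences of strictness on the inactive set *)

Lemma inactive_max_lt1P (R : realType) (p : nat) (beta s : 'cV[R]_p) :
  reflect (forall j, j \notin active beta -> `|s j 0| < 1)
          (inactive_max beta s < 1).
Proof.
apply: (iffP (bigmax_ltP _ _ _ _)) => [[_ h] j|h].
  by move=> jA; apply: h; rewrite inE.
by split=> [|j]; rewrite ?ltr01// inE; exact: h.
Qed.

(* For [lam = 0] an inactive component of the subgradient could be set to 1. *)
Lemma inactive_lam_gt0 (R : realType) (n p : nat) (X : 'M[R]_(n, p))
  (y : 'cV[R]_n) (lam : R) (beta s : 'cV[R]_p) (j : 'I_p) :
  0 <= lam -> lasso_subgrad X y lam beta s ->
  (forall u, lasso_subgrad X y lam beta u -> inactive_max beta u < 1) ->
  j \notin active beta -> 0 < lam.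
Proof.
move=> lam0 [hs hopt] hstrict jA; rewrite lt_neqAle lam0 andbT eq_sym.
apply/eqP => l0; pose u : 'cV[R]_p := \col_i (if i == j then 1 else s i 0).
have hu : lasso_subgrad X y lam beta u.
  split; last by move: hopt; rewrite l0 !scale0r.
  move=> i; rewrite mxE; case: (i =P j) => [->|_]; last exact: hs.
  by split=> [b0|_]; [move: jA; rewrite inE b0 | apply/andP; split; lra].
have /inactive_max_lt1P/(_ j jA) := hstrict u hu.
by rewrite mxE eqxx normr1 ltxx.
Qed.

(** * The step length and the path up to it *)

Lemma step_gt0 (R : realType) (n p : nat) (X : 'M[R]_(n, p))
  (b : 'cV[R]_n) (lam : R) (beta s : 'cV[R]_p) :
  (0 < step X b lam beta s)%E.
Proof.
have pp m : (0 < ppart m :> \bar R)%E by rewrite /ppart; case: ifP; rewrite ?ltry.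
by rewrite lt_min; apply/andP; split; apply: lt_bigmin; rewrite ?ltry// => i _;
   exact: pp.
Qed.

(** A finite minimum over finitely many terms is attained, and the attaining term is the hitting
    time of its coordinate. *)
Lemma step_attained (R : realType) (n p : nat) (X : 'M[R]_(n, p))
  (b : 'cV[R]_n) (lam : R) (beta s : 'cV[R]_p) (t : R) :
  step X b lam beta s = t%:E ->
  (exists2 j, j \in active beta &
     beta j 0 + t * path_dir X b (active beta) j 0 = 0) \/
  (exists2 j, j \in ~: active beta &
     `|s j 0 + t / lam * dual_dir X b (active beta) j 0| = 1).
Proof.
move=> st; have : (t%:E <= step X b lam beta s)%E by rewrite st.
rewrite le_min => /andP[/bigmin_geP[_ h1] /bigmin_geP[_ h2]].
have : (step X b lam beta s <= t%:E)%E by rewrite st.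
(* The default [+oo] of each minimum cannot lie below the finite [t]. *)
rewrite ge_min => /orP[] /bigmin_leP[|[k _ hk]]; rewrite ?leye_eq//.
- left; exists (enum_val k); first exact: enum_valP.
  by rewrite path_dir_enum_val; apply/ppart_root/le_anti; rewrite hk h1.
- right; exists (enum_val k); first exact: enum_valP.
  by rewrite dual_dir_enum_val; apply/ppart_norm_eq1/le_anti; rewrite hk h2.
Qed.

Lemma path_active_sg (R : realType) (n p : nat) (X : 'M[R]_(n, p))
  (b : 'cV[R]_n) (lam : R) (beta s : 'cV[R]_p) (t : R) (j : 'I_p) :
  0 <= t -> (t%:E <= step X b lam beta s)%E -> j \in active beta ->
  beta j 0 + t * path_dir X b (active beta) j 0 != 0 ->
  Num.sg (beta j 0 + t * path_dir X b (active beta) j 0) = Num.sg (beta j 0).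
Proof.
move=> t0; rewrite le_min => /andP[/bigmin_geP[_ h] _] jA.
rewrite -(enum_rankK_in jA jA) path_dir_enum_val; apply: ppart_sg_le => //.
  by have := enum_valP (enum_rank_in jA j); rewrite inE.
exact: h.
Qed.

Lemma path_active_neq0 (R : realType) (n p : nat) (X : 'M[R]_(n, p))
  (b : 'cV[R]_n) (lam : R) (beta s : 'cV[R]_p) (t : R) (j : 'I_p) :
  0 <= t -> (t%:E < step X b lam beta s)%E -> j \in active beta ->
  beta j 0 + t * path_dir X b (active beta) j 0 != 0.
Proof.
move=> t0; rewrite lt_min => /andP[/bigmin_gtP[_ h] _] jA.
have b0 := jA; rewrite inE -(enum_rankK_in jA jA) in b0.
rewrite -(enum_rankK_in jA jA) path_dir_enum_val.
by rewrite -sgr_eq0 ppart_sg_stable ?sgr_eq0//; exact: h.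
Qed.

Lemma path_inactive_le1 (R : realType) (n p : nat) (X : 'M[R]_(n, p))
  (b : 'cV[R]_n) (lam : R) (beta s : 'cV[R]_p) (t : R) (j : 'I_p) :
  0 <= t -> (t%:E <= step X b lam beta s)%E -> j \notin active beta ->
  0 < lam -> `|s j 0| < 1 ->
  `|s j 0 + t / lam * dual_dir X b (active beta) j 0| <= 1.
Proof.
move=> t0; rewrite le_min => /andP[_ /bigmin_geP[_ h]]; rewrite -in_setC => jA.
move=> lam0; rewrite -(enum_rankK_in jA jA) dual_dir_enum_val => sj.
by apply: ppart_norm_le1 => //; exact: h.
Qed.

Lemma path_inactive_lt1 (R : realType) (n p : nat) (X : 'M[R]_(n, p))
  (b : 'cV[R]_n) (lam : R) (beta s : 'cV[R]_p) (t : R) (j : 'I_p) :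
  0 <= t -> (t%:E < step X b lam beta s)%E -> j \notin active beta ->
  0 < lam -> `|s j 0| < 1 ->
  `|s j 0 + t / lam * dual_dir X b (active beta) j 0| < 1.
Proof.
move=> t0; rewrite lt_min => /andP[_ /bigmin_gtP[_ h]]; rewrite -in_setC => jA.
move=> lam0; rewrite -(enum_rankK_in jA jA) dual_dir_enum_val => sj.
by apply: ppart_norm_lt1 => //; exact: h.
Qed.

(** The case [t = step] is included on purpose: it identifies the solution at the transition
    itself. *)
Lemma lasso_subgrad_path (R : realType) (n p : nat) (X : 'M[R]_(n, p))
  (y b : 'cV[R]_n) (lam : R) (beta s : 'cV[R]_p) (t : R) :
  gram X (active beta) \in unitmx -> lasso_subgrad X y lam beta s ->
  (forall j, j \notin active beta -> 0 < lam /\ `|s j 0| < 1) ->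
  0 <= t -> (t%:E <= step X b lam beta s)%E ->
  lasso_subgrad X (y + t *: b) lam (beta + t *: path_dir X b (active beta))
    (s + (t / lam) *: dual_dir X b (active beta)).
Proof.
move=> gu [hs hopt] hin t0 ht; set v := path_dir _ _ _; set w := dual_dir _ _ _.
split=> [j|].
  have [jA|jA] := boolP (j \in active beta).
    have wj : w j 0 = 0 by exact: dual_dir_in.
    have sj : s j 0 = Num.sg (beta j 0).
      by apply: (hs j).1; move: jA; rewrite inE.
    rewrite !entry_addZ wj mulr0 addr0 sj; split=> [cn0|_].
      exact/esym/(path_active_sg t0 ht jA cn0).
    (* An active coefficient may vanish at the endpoint; its former sign is still an admissible
       subgradient component. *)
    by rewrite -ler_norml normr_sg lern1 leq_b1.
  have [lam0 sj] := hin j jA.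
  have bj : beta j 0 = 0 by move: jA; rewrite inE negbK => /eqP.
  have vj : v j 0 = 0 by exact: path_dir_notin.
  rewrite !entry_addZ bj vj mulr0 addr0 eqxx; split=> // _.
  by rewrite -ler_norml; exact: path_inactive_le1.
(* If [lam = 0], every feature is active by the hypothesis on inactive ones, so the dual direction
   is zero and both sides vanish. *)
have lw : lam *: ((t / lam) *: w) = t *: w.
  apply/colP => j; rewrite scalerA mxE [RHS]mxE.
  have [jA|/hin[lam0 _]] := boolP (j \in active beta).
    by rewrite (dual_dir_in b gu jA) !mulr0.
  by rewrite [lam * _]mulrC divfK// lt0r_neq0.
rewrite scalerDr lw /w /dual_dir -/v.
have -> : X *m (beta + t *: v) - (y + t *: b)
          = (X *m beta - y) - t *: (b - X *m v).
  by rewrite mulmxDr -scalemxAr scalerBr opprB opprD addrACA.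
by rewrite mulmxBr -scalemxAr addrACA hopt addNr addr0.
Qed.

Theorem lemma2 (R : realType) (n p : nat) (X : 'M[R]_(n, p))
  (yobs : 'cV[R]_n) (Sigma : 'M[R]_n) (lam : R)
  (hSigma : covariance_mx Sigma) (hlam : 0 <= lam)
  (beta_obs : 'cV[R]_p) (hobs : lasso_argmin X yobs lam beta_obs)
  (k : 'I_#|active beta_obs|)
  (hgram_obs : gram X (active beta_obs) \in unitmx)
  (eta b a : 'cV[R]_n) (y : R -> 'cV[R]_n)
  (heta : eta = colsel X (active beta_obs)
                *m invmx (gram X (active beta_obs)) *m delta_mx k 0)
  (hSigma_eta : eta^T *m Sigma *m eta \in unitmx)
  (hb : b = Sigma *m eta *m invmx (eta^T *m Sigma *m eta))
  (ha : a = (1%:M - b *m eta^T) *m yobs)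
  (hy : forall z : R, y z = a + z *: b)
  (beta : R -> 'cV[R]_p)
  (hbeta : forall z : R, lasso_unique_argmin X (y z) lam (beta z))
  (hgram : forall z : R, gram X (active (beta z)) \in unitmx)
  (s : R -> 'cV[R]_p)
  (hs : forall z : R, lasso_subgrad X (y z) lam (beta z) (s z))
  (z : R)
  (hz : forall u : 'cV[R]_p, lasso_subgrad X (y z) lam (beta z) u ->
        inactive_max (beta z) u < 1) :
  (forall z' : R, z <= z' ->
     (z'%:E < z%:E + step X b lam (beta z) (s z))%E ->
     [/\ active (beta z') = active (beta z),
         inactive_max (beta z') (s z') < 1
       & sgv (beta z) = sgv (beta z')]) /\
  transition_point beta s z (z%:E + step X b lam (beta z) (s z))%E.
Proof.
set v := path_dir X b (active (beta z)).
set w := dual_dir X b (active (beta z)).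
set S := step X b lam (beta z) (s z).
have hin j : j \notin active (beta z) -> 0 < lam /\ `|s z j 0| < 1.
  move=> jA; split; first exact: (inactive_lam_gt0 hlam (hs z) hz jA).
  exact: (inactive_max_lt1P _ _ (hz _ (hs z))).
have ltS r : (r%:E < z%:E + S)%E = ((r - z)%:E < S)%E.
  by case: S => [x||] //=; rewrite -?EFinD ?lte_fin ?ltrBlDl ?ltry.
(* The explicit path satisfies the optimality conditions, so uniqueness of the minimizer identifies
   it with [beta r]. *)
have sol r : z <= r -> ((r - z)%:E <= S)%E ->
    lasso_subgrad X (y r) lam (beta r) (s z + ((r - z) / lam) *: w) /\
    beta r = beta z + (r - z) *: v.
  move=> zr hr.
  have yE : y r = y z + (r - z) *: b.
    by rewrite !hy -addrA -scalerDl [z + _]addrC subrK.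
  have := lasso_subgrad_path (hgram z) (hs z) hin _ hr.
  rewrite subr_ge0 -yE => /(_ zr) sg.
  suff -> : beta r = beta z + (r - z) *: v by [].
  exact/esym/(hbeta r).2/(lasso_subgrad_argmin hlam sg).
(* An inactive feature forces [lam > 0], so the given [s r] must be the explicit subgradient. *)
have dual r j : z <= r -> ((r - z)%:E <= S)%E -> j \notin active (beta z) ->
    s r j 0 = s z j 0 + (r - z) / lam * w j 0.
  move=> zr hr jA; have [hsub _] := sol r zr hr.
  by rewrite (lasso_subgrad_uniq (hin j jA).1 (hs r) hsub) entry_addZ.
have activeE r : z <= r -> ((r - z)%:E < S)%E ->
    active (beta r) = active (beta z).
  move=> zr hr; apply/setP => j; rewrite inE (sol r zr (ltW hr)).2 entry_addZ.
  have [jA|jA] := boolP (j \in active (beta z)).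
    by apply: path_active_neq0 hr jA; rewrite subr_ge0.
  rewrite /v path_dir_notin// mulr0 addr0.
  by move: jA; rewrite inE => /negbTE.
have inact r j : z <= r -> ((r - z)%:E < S)%E -> j \notin active (beta z) ->
    `|s r j 0| < 1.
  move=> zr hr jA; have [lam0 sj] := hin j jA; rewrite (dual r j zr (ltW hr) jA).
  by apply: path_inactive_lt1 hr jA lam0 sj; rewrite subr_ge0.
split=> [r zr|].
  rewrite ltS => hr; split; first exact: activeE.
    apply/inactive_max_lt1P => j; rewrite activeE// => jA; exact: inact jA.
  (* Active coefficients keep their sign; inactive ones are zero at both ends. *)
  apply/colP => j; rewrite [LHS]mxE [RHS]mxE.
  have [jA|jA] := boolP (j \in active (beta z)).
    rewrite (sol r zr (ltW hr)).2 entry_addZ; apply/esym.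
    have t0 : 0 <= r - z by rewrite subr_ge0.
    exact: (path_active_sg t0 (ltW hr) jA (path_active_neq0 t0 hr jA)).
  move: (jA); rewrite -(activeE r zr hr) inE negbK => /eqP ->.
  by move: jA; rewrite inE negbK => /eqP ->.
have S0 : (0 < S)%E by exact: step_gt0.
split.
- by rewrite ltS subrr.
- by exists v => r zr; rewrite ltS => hr; exact: (sol r zr (ltW hr)).2.
- move=> r zr; rewrite ltS => hr [[j jA]|[j]].
    by move/eqP; apply/negP; move: jA; rewrite -(activeE r zr hr) inE.
  by rewrite inE => jA s1; have := inact r j zr hr jA; rewrite s1 ltxx.
(* A finite transition value makes the step finite, hence attained by some coordinate, which
   supplies the event. *)
- move=> r hr; have SE : S = (r - z)%:E.
    by move: hr; case: (S) => [x||] //= [<-]; rewrite addrAC subrr add0r.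
  have zr : z <= r by rewrite -subr_ge0 -lee_fin -SE ltW.
  have hle : ((r - z)%:E <= S)%E by rewrite SE.
  have [[j jA e]|[j jA e]] := step_attained SE; [left|right]; exists j => //.
    by rewrite (sol r zr hle).2 entry_addZ.
  by rewrite dual//; move: jA; rewrite inE.
Qed.
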